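(* For $p\in\{21,12,132,213,123\}$ let $K_p(x,y)$ be the bivariate generating function in which the coefficient of $x^ny^k$ ($n,k\ge0$) is the number of faro permutations of length $n$ containing exactly $k$ occurrences of the consecutive pattern $p$. Then $$K_{21}(x,y)=\frac{2}{1-2x+\sqrt{1-4x^2y}},$$ $$K_{12}(x,y)=\frac{1+y+2xy-2xy^2+(y-1)\sqrt{1-4x^2y}}{y\left(1-2xy+\sqrt{1-4x^2y}\right)},$$ $$K_{132}(x,y)=K_{213}(x,y)=\frac{1+y+(y-1)\sqrt{1-4x^2y}}{y\left(1-2x+\sqrt{1-4x^2y}\right)},$$ $$K_{123}(x,y)=\frac{2+3x-3xy+2x^2-2x^2y-x(1-y)\sqrt{1-4x^2}}{1-2xy+\sqrt{1-4x^2}}.$$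
   Context: A faro permutation of length $n$ is a permutation $w=w_1\cdots w_n$ of $\{1,\dots,n\}$ obtained by interlacing two increasing words $u,v$ as $u_1v_1u_2v_2\cdots$ with $0\le|u|-|v|\le1$ (equivalently, $w_i<w_{i+2}$ for all $1\le i\le n-2$). The empty permutation is a faro permutation of length $0$. An occurrence of a consecutive pattern $p=p_1\cdots p_m$ in $w$ is a factor $w_iw_{i+1}\cdots w_{i+m-1}$ order-isomorphic to $p$. Generating functions are formal power series and square roots denote the branch with constant term $1$. *)

(* Defs.v *)
From HB Require Import structures.
From mathcomp Require Import all_boot all_order all_algebra perm.
From mathcomp Require Import boolp classical_sets.

Set Implicit Arguments.
Unset Strict Implicit.
Unset Printing Implicit Defensive.

Import Order.TTheory GRing.Theory Num.Theory.

Local Open Scope ring_scope.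

(** * Formal power series

  [fps R] is R[[t]].  It is a record rather than a bare [nat -> R] so that it
  does not inherit the pointwise ring structure of functions.  Iterating it
  gives R[[y]][[x]] = R[[x, y]]. *)

Record fps (R : Type) := Fps { fcoef :> nat -> R }.

Lemma fpsP (R : Type) (f g : fps R) : (forall n, f n = g n) -> f = g.
Proof. by case: f g => [f] [g] /= fg; congr Fps; apply/funext. Qed.

HB.instance Definition _ (R : Type) := gen_eqMixin (fps R).
HB.instance Definition _ (R : Type) := gen_choiceMixin (fps R).

Section FpsZmodule.
Variable R : zmodType.
Implicit Types f g h : fps R.

Definition fps_zero : fps R := Fps (fun=> 0).
Definition fps_opp f : fps R := Fps (fun n => - f n).
Definition fps_add f g : fps R := Fps (fun n => f n + g n).

Lemma fps_addA : associative fps_add.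
Proof. by move=> f g h; apply: fpsP => n; apply: addrA. Qed.
Lemma fps_addC : commutative fps_add.
Proof. by move=> f g; apply: fpsP => n; apply: addrC. Qed.
Lemma fps_add0 : left_id fps_zero fps_add.
Proof. by move=> f; apply: fpsP => n; apply: add0r. Qed.
Lemma fps_addN : left_inverse fps_zero fps_opp fps_add.
Proof. by move=> f; apply: fpsP => n; apply: addNr. Qed.

HB.instance Definition _ :=
  GRing.isZmodule.Build (fps R) fps_addA fps_addC fps_add0 fps_addN.

Lemma fcoef0 n : (0 : fps R) n = 0. Proof. by []. Qed.
Lemma fcoefN f n : (- f) n = - f n. Proof. by []. Qed.
Lemma fcoefD f g n : (f + g) n = f n + g n. Proof. by []. Qed.
Lemma fcoefB f g n : (f - g) n = f n - g n. Proof. by []. Qed.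

End FpsZmodule.

Section FpsComRing.
Variable R : comNzRingType.
Implicit Types f g h : fps R.

Definition fps_one : fps R := Fps (fun n => (n == 0%N)%:R).
Definition fps_mul f g : fps R :=
  Fps (fun n => \sum_(i < n.+1) f i * g (n - i)%N).

Definition fps_trunc m f : {poly R} := \poly_(i < m) f i.

Lemma coef_fps_trunc m f i : (i < m)%N -> (fps_trunc m f)`_i = f i.
Proof. by move=> im; rewrite coef_poly im. Qed.

Lemma fps_mul_trunc m f g i : (i < m)%N ->
  fps_mul f g i = (fps_trunc m f * fps_trunc m g)`_i.
Proof.
move=> im; rewrite coefM; apply: eq_bigr => j _.
rewrite !coef_fps_trunc //.
  exact: leq_ltn_trans (leq_subr _ _) im.
exact: leq_ltn_trans (leq_ord j) im.
Qed.

Lemma fps_mulC : commutative fps_mul.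
Proof.
by move=> f g; apply: fpsP => n; rewrite !(@fps_mul_trunc n.+1) // mulrC.
Qed.

Lemma fps_mulA : associative fps_mul.
Proof.
move=> f g h; apply: fpsP => n; rewrite !(@fps_mul_trunc n.+1) //.
transitivity (fps_trunc n.+1 f * (fps_trunc n.+1 g * fps_trunc n.+1 h))`_n.
  rewrite !(coefM (fps_trunc _ f)); apply: eq_bigr => j _.
  have jn : (n - j < n.+1)%N by rewrite ltnS leq_subr.
  congr (_ * _); rewrite coef_fps_trunc //; exact: fps_mul_trunc.
rewrite mulrA !coefM; apply: eq_bigr => j _.
have jn := ltn_ord j.
by congr (_ * _); rewrite coef_fps_trunc //; apply/esym/fps_mul_trunc.
Qed.

Lemma fps_mul1 : left_id fps_one fps_mul.
Proof.
move=> f; apply: fpsP => n /=; rewrite big_ord_recl big1 /=.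
  by rewrite addr0 mul1r subn0.
by move=> i _; rewrite mul0r.
Qed.

Lemma fps_mulDl : left_distributive fps_mul (@GRing.add (fps R)).
Proof.
move=> f g h; apply: fpsP => n; rewrite [RHS]fcoefD /= -big_split /=.
by apply: eq_bigr => i _; rewrite mulrDl.
Qed.

Lemma fps_one_neq0 : fps_one != 0.
Proof.
apply/eqP => /(congr1 (fun f : fps R => f 0%N)) /eqP.
by rewrite fcoef0 oner_eq0.
Qed.

HB.instance Definition _ := GRing.Zmodule_isComNzRing.Build (fps R)
  fps_mulA fps_mulC fps_mul1 fps_mulDl fps_one_neq0.

Lemma fcoef1 n : (1 : fps R) n = (n == 0%N)%:R. Proof. by []. Qed.
Lemma fcoefM f g n : (f * g) n = \sum_(i < n.+1) f i * g (n - i)%N.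
Proof. by []. Qed.

Definition fpsC (a : R) : fps R := Fps (fun n => if n == 0%N then a else 0).
Definition fpsX : fps R := Fps (fun n => (n == 1%N)%:R).

Lemma fpsCM a f n : (fpsC a * f) n = a * f n.
Proof.
rewrite fcoefM big_ord_recl big1 /= ?addr0 ?subn0 //.
by move=> i _; rewrite mul0r.
Qed.

Definition fps_unit : pred (fps R) := fun f => `[< exists g, g * f = 1 >].
Definition fps_inv f : fps R :=
  if fps_unit f then xget 0 [set g | g * f = 1]%classic else f.

Lemma fps_mulVx : {in fps_unit, left_inverse 1 fps_inv *%R}.
Proof.
move=> f fu; have {}fu : fps_unit f := fu; rewrite /fps_inv fu.
exact: (xgetPex (0 : fps R) (asboolW fu)).
Qed.

Lemma fps_unitPl f g : g * f = 1 -> fps_unit f.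
Proof. by move=> gf; apply/asboolP; exists g. Qed.

Lemma fps_inv_out : {in [predC fps_unit], fps_inv =1 id}.
Proof. by move=> f fu; rewrite /fps_inv ifN. Qed.

HB.instance Definition _ := GRing.ComNzRing_hasMulInverse.Build (fps R)
  fps_mulVx fps_unitPl fps_inv_out.

End FpsComRing.

Section FpsIdomain.
Variable R : idomainType.
Implicit Types f g : fps R.

Lemma fps_order f : f != 0 ->
  exists n, f n != 0 /\ forall m, (m < n)%N -> f m = 0.
Proof.
move=> f0; have ex : exists n, f n != 0.
  apply: contrapT => nex; move/eqP: f0; apply; apply: fpsP => n.
  by apply/eqP/negPn/negP => fn; apply: nex; exists n.
case: (ex_minnP ex) => n fn nmin; exists n; split=> // m mn.
by apply/eqP; apply: contraLR mn; rewrite -leqNgt; apply: nmin.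
Qed.

Lemma fps_integral f g : f * g = 0 -> (f == 0) || (g == 0).
Proof.
move=> fg; apply: contraT; rewrite negb_or => /andP[].
move=> /fps_order[m [fm f0]] /fps_order[n [gn g0]].
have : (f * g) (m + n)%N = 0 by rewrite fg.
have im : (m < (m + n).+1)%N by rewrite ltnS leq_addr.
rewrite fcoefM (bigD1 (Ordinal im)) //= big1 => [|i /negP im'].
  by rewrite addr0 addKn => /eqP; rewrite mulf_eq0 (negPf fm) (negPf gn).
have [lt_im|lt_mi|eq_im] := ltngtP (i : nat) m.
- by rewrite f0 ?mul0r.
- by rewrite g0 ?mulr0 // ltn_subLR ?ltn_add2r // -ltnS ltn_ord.
- by case: im'; apply/eqP/val_inj.
Qed.

HB.instance Definition _ :=
  GRing.ComUnitRing_isIntegral.Build (fps R) fps_integral.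

End FpsIdomain.

(** * Bivariate series over the rationals

  The outer variable is x and the inner one is y: the coefficient of x^n y^k
  in [f] is [f n k].  Quotients of series are taken in the fraction field, as
  y is not invertible in the ring of power series. *)

Notation fps2 := (fps (fps rat)).

Definition xvar : fps2 := fpsX _.
Definition yvar : fps2 := fpsC (fpsX _).

Notation "x %:F" := (@FracField.tofrac _ x) : ring_scope.

(** The square root of [f] with constant term 1 (and 0 if there is none). *)
Definition fps_sqrt (f : fps2) : fps2 :=
  xget 0 [set s : fps2 | s ^+ 2 = f /\ s 0%N 0%N = 1]%classic.

Section SqrtExists.
Variable R : comNzRingType.
Variable half : R.
Hypothesis half2 : half + half = 1.
Implicit Types f g t u : fps R.

(* With f = 1 + g, the root 1 + t is the limit of t |-> (g - t^2) / 2. *)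
Let step g t : fps R := fpsC half * (g - t * t).
Let approx g n := iter n (step g) 0.

Let step_agree g t u n : t 0%N = 0 -> u 0%N = 0 ->
  (forall i, (i < n)%N -> t i = u i) ->
  forall i, (i < n.+1)%N -> step g t i = step g u i.
Proof.
move=> t0 u0 tu i ilen; rewrite !fpsCM !fcoefB !fcoefM; congr (_ * (_ - _)).
apply: eq_bigr => -[[|j] /= ji] _; first by rewrite t0 u0 !mul0r.
have [->|jni] := eqVneq j.+1 i; first by rewrite subnn t0 u0 !mulr0.
rewrite !tu //.
  by apply: leq_trans (_ : i <= n)%N; rewrite // -subSn // subSS leq_subr.
by apply: leq_trans (_ : i <= n)%N; rewrite // ltn_neqAle jni -ltnS.
Qed.

Let step0 g t : g 0%N = 0 -> t 0%N = 0 -> step g t 0%N = 0.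
Proof.
move=> g0 t0; rewrite fpsCM fcoefB fcoefM big_ord1 /= g0 t0.
by rewrite mulr0 subr0 mulr0.
Qed.

Let approx0 g n : g 0%N = 0 -> approx g n 0%N = 0.
Proof. by move=> g0; elim: n => [|n IH] //=; apply: step0. Qed.

Let approxS g n : g 0%N = 0 ->
  forall i, (i < n)%N -> approx g n.+1 i = approx g n i.
Proof.
move=> g0; elim: n => [|n IH] // i ilen.
exact: (step_agree g (approx0 n.+1 g0) (approx0 n g0) IH ilen).
Qed.

Let approx_stable g m n : g 0%N = 0 -> (m <= n)%N ->
  forall i, (i < m)%N -> approx g n i = approx g m i.
Proof.
move=> g0 /subnKC <- i im; elim: (n - m)%N => [|k IH]; first by rewrite addn0.
by rewrite addnS approxS ?IH // (leq_trans im) // leq_addr.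
Qed.

Lemma fps_sqrt_exists f : f 0%N = 1 ->
  exists2 s : fps R, s ^+ 2 = f & s 0%N = 1.
Proof.
move=> f0; pose g := f - 1.
have g0 : g 0%N = 0 by rewrite fcoefB f0 fcoef1 subrr.
pose t : fps R := Fps (fun n => approx g n.+1 n).
have t0 : t 0%N = 0 by apply: (approx0 1 g0).
have tfix : t = step g t.
  apply: fpsP => n; rewrite [LHS]/=.
  apply: (@step_agree g _ _ n) => //; first exact: (approx0 n g0).
  by move=> i ilen; apply: approx_stable.
exists (1 + t); last by rewrite fcoefD t0 addr0 fcoef1.
have half2C : fpsC half + fpsC half = 1.
  by apply: fpsP => -[|n]; rewrite fcoefD fcoef1 /= ?half2 ?addr0.
have t2 : t + t = g - t * t by rewrite {1 2}tfix /step -mulrDl half2C mul1r.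
rewrite expr2 mulrDl mul1r mulrDr mulr1 -addrA [t + (t + _)]addrA t2.
by rewrite subrK addrC subrK.
Qed.

End SqrtExists.

Lemma fps_sqrtP (f : fps2) : f 0%N = 1 ->
  fps_sqrt f ^+ 2 = f /\ fps_sqrt f 0%N 0%N = 1.
Proof.
move=> f0.
suff ex : exists s : fps2, s ^+ 2 = f /\ s 0%N 0%N = 1.
  exact: (xgetPex (0 : fps2) ex).
have half2 : fpsC (2^-1 : rat) + fpsC (2^-1) = 1.
  by apply: fpsP => -[|n]; rewrite fcoefD fcoef1 /=.
by have [s sf s0] := fps_sqrt_exists half2 f0; exists s; rewrite s0.
Qed.

Lemma fps_sqrt_unique (s t : fps2) : s ^+ 2 = t ^+ 2 ->
  s 0%N 0%N = 1 -> t 0%N 0%N = 1 -> s = t.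
Proof.
move=> /eqP; rewrite eqf_sqr => /orP[/eqP //|/eqP ->].
by rewrite !fcoefN => nt t1; rewrite t1 in nt.
Qed.

(** * Faro permutations and consecutive patterns *)

Local Open Scope nat_scope.

(* u1 v1 u2 v2 ... *)
Fixpoint interlace (u v : seq nat) : seq nat :=
  if u is a :: u' then
    if v is b :: v' then a :: b :: interlace u' v' else u
  else v.

Definition faro_word (w : seq nat) : Prop :=
  exists u v : seq nat,
    [/\ sorted ltn u, sorted ltn v, size v <= size u <= (size v).+1
      & w = interlace u v].

(* The one-line notation w1 ... wn, with letters in {1, ..., n}. *)
Definition one_line n (w : 'S_n) : seq nat := [seq (w i : nat).+1 | i : 'I_n].

Definition order_iso (s t : seq nat) : bool :=
  (size s == size t) &&
  [forall i : 'I_(size s), forall j : 'I_(size s),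
     (nth 0 s i < nth 0 s j) == (nth 0 t i < nth 0 t j)].

Definition occurrences (p w : seq nat) : nat :=
  \sum_(i < (size w).+1) order_iso (take (size p) (drop i w)) p.

Definition faro_count (p : seq nat) (n k : nat) : nat :=
  #|[set w : 'S_n | `[< faro_word (one_line w) >]
                    & occurrences p (one_line w) == k]|.

Definition faro_gf (p : seq nat) : fps2 :=
  Fps (fun n => Fps (fun k => (faro_count p n k)%:R%R)).

(* Main.v *)
Require Import Defs.
From HB Require Import structures.
From mathcomp Require Import all_boot all_order all_algebra perm.
From mathcomp Require Import boolp classical_sets.
From mathcomp Require Import zify ring.

Import GRing.Theory.

Set Implicit Arguments.
Unset Strict Implicit.
Unset Printing Implicit Defensive.

Local Open Scope ring_scope.

(** A faro permutation is determined by the word b of booleans saying of each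
  value, in increasing order, whether it belongs to u (the odd places of w) or
  to v (the even places).  Reading b as a lattice path with height
  h = #true - #false, faro permutations become the paths from 0 that end at
  height 0 or 1 ([faro_word_parity], [faro_of_perm]).

  Statistics.  Write the values 1, 2, ... into the slots of w one by one.  The
  descent w_j > w_(j+1) says that slot j+1 is already filled when w_j is
  written, that is, that the list which receives w_j lags behind the other
  one: the path makes a step towards the pair of heights {0, 1} from outside
  of it ([descents_inward_count]).  Because w_i < w_(i+2), two descents are
  never adjacent and each pattern of length 3 only depends on two consecutive
  comparisons: 132 is a descent not at the first position, 213 a descent not
  at the last one, 123 a pair of consecutive ascents.  So all five counts are
  affine in the number d of inward steps, corrected by whether the first step
  goes down and whether the last step is inward ([faro_statistics]).

  Generating functions.  Give a path a weight that is a product over its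
  steps: al for a step inside {0, 1}, be for an outward step, ga for an inward
  step, with nu in place of be for a downward first step and mu in place of ga
  for an inward last step.  Outward and inward steps are equally many, so a
  faro permutation of length n has weight
     al^(n - 2d) be^(d - f) nu^f ga^(d - l) mu^l
  ([word_weightE]), where f and l are the two corrections.  Substituting 1 or y
  for the five parameters gives each K_p, up to a factor y or y^2 and an
  adjustment of the first coefficients for the patterns 12 and 123.

  Solution.  The series G_k of the weighted paths starting at distance k from
  {0, 1} satisfy an infinite linear system, in which every occurrence on the
  right carries a factor x.  Put D = (1 + sqrt(1 - 4 x^2 be ga)) / 2, the
  inverse of a Catalan series, so that D^2 = D - x^2 be ga.  Then
  H_k = D G_(k+1) - x ga G_k (with a correction at k = 0) satisfies
  D H_k = x be H_(k+1), which forces H = 0 by comparing coefficients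
  ([fps_contraction]).  This gives G_1 in terms of G_0, and the system is
  reduced to two linear equations. *)

(** * Power series *)

Section SeriesFacts.
Variable A : comNzRingType.
Implicit Types f g : fps A.

Lemma fpsXM0 f : (fpsX A * f) 0%N = 0.
Proof. by rewrite fcoefM big_ord1 mul0r. Qed.

Lemma fpsXMS f n : (fpsX A * f) n.+1 = f n.
Proof.
rewrite fcoefM !big_ord_recl /= mul0r add0r mul1r subSS subn0.
by rewrite big1 ?addr0 // => i _; rewrite mul0r.
Qed.

Lemma fcoefM0 f g : (f * g) 0%N = f 0%N * g 0%N.
Proof. by rewrite fcoefM big_ord1. Qed.

Lemma fpsC_is_additive : zmod_morphism (@fpsC A).
Proof. by move=> a b; apply: fpsP => -[|n]; rewrite fcoefB ?subr0. Qed.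
HB.instance Definition _ := GRing.isZmodMorphism.Build A (fps A) (@fpsC A)
  fpsC_is_additive.
Lemma fpsC_is_monoid : monoid_morphism (@fpsC A).
Proof.
split=> [|a b]; first by apply: fpsP => -[|n].
by apply: fpsP => -[|n]; rewrite fpsCM /= ?mulr0.
Qed.
HB.instance Definition _ := GRing.isMonoidMorphism.Build A (fps A) (@fpsC A)
  fpsC_is_monoid.

Lemma fpsC0 (a : A) : fpsC a 0%N = a. Proof. by []. Qed.
Lemma fpsCS (a : A) n : fpsC a n.+1 = 0. Proof. by []. Qed.

Lemma coef_fpsXn m n : (fpsX A ^+ m) n = (n == m)%:R.
Proof.
elim: m n => [|m IH] n; first by rewrite expr0.
by rewrite exprS; case: n => [|n]; rewrite ?fpsXM0 ?fpsXMS ?IH ?eqSS.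
Qed.

(** The coefficient of x^n in [H k] is expressed by coefficients of lower degree
  of [H k] and [H k.+1], so it vanishes by induction on n, for all k at once. *)
Lemma fps_contraction (D : fps A) (H : nat -> fps A) (b : fps A) :
  D 0%N = 1 -> (forall k, D * H k = fpsX A * b * H k.+1) -> forall k, H k = 0.
Proof.
move=> D0 rec.
suff H0 n : forall k, H k n = 0 by move=> k; apply: fpsP => n; apply: H0.
elim/ltn_ind: n => n IH k.
have: (D * H k) n = H k n.
  rewrite fcoefM big_ord_recl subn0 D0 mul1r big1 ?addr0 // => i _.
  by rewrite IH ?mulr0 // ltn_subrL /= (leq_ltn_trans _ (ltn_ord i)).
move=> <-; rewrite rec -mulrA; case: n IH => [|n] IH; first exact: fpsXM0.
rewrite fpsXMS fcoefM big1 // => i _.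
by rewrite IH ?mulr0 // ltnS leq_subr.
Qed.

End SeriesFacts.

(** The square root enters only through [D], the root of D^2 - D + q with
  constant term 1. *)
Lemma fps_sqrt_half (q : fps2) : q 0%N = 0 ->
  exists D : fps2, [/\ D 0%N = 1, fps_sqrt (1 - 4 * q) = 2 * D - 1
                     & D ^+ 2 = D - q].
Proof.
move=> q0; pose s := fps_sqrt (1 - 4 * q).
have f0 : (1 - 4 * q) 0%N = 1 by rewrite fcoefB fcoef1 fcoefM0 q0 mulr0 subr0.
have [s2 s00] := fps_sqrtP f0; rewrite -/s in s2 s00 *.
pose h : fps2 := fpsC (fpsC 2^-1).
have h2 : 2 * h = 1.
  rewrite /h mulrC mulr_natr -!rmorphMn /= -mulr_natr mulVf //.
  by rewrite !rmorph1.
have s0 : s 0%N = 1.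
  have : s 0%N ^+ 2 = 1 ^+ 2 by rewrite expr1n expr2 -fcoefM0 -expr2 s2.
  move=> /eqP; rewrite eqf_sqr => /orP[/eqP //|/eqP sN].
  by move: s00; rewrite sN fcoefN fcoef1.
exists (h * (1 + s)); split.
- have := congr1 (fun f : fps2 => f 0%N) h2.
  by rewrite !fcoefM0 !fcoefD s0 fcoef1 mulrC.
- by rewrite mulrA h2; ring.
have -> : (h * (1 + s)) ^+ 2 = h * h * (1 + 2 * s + s ^+ 2) by ring.
rewrite s2; have -> : h * h * (1 + 2 * s + (1 - 4 * q)) =
   (2 * h) * h * (1 + s) - (2 * h) * (2 * h) * q by ring.
by rewrite h2; ring.
Qed.

Lemma tofrac_div (R : idomainType) (k num den : R) : den != 0 ->
  k * den = num -> k%:F = num%:F / den%:F.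
Proof. by move=> den0 <-; rewrite tofracM mulfK // tofrac_eq0. Qed.

Lemma fps2_two_neq0 : 2 != 0 :> fps2.
Proof.
apply/eqP => /(congr1 (fun f : fps2 => f 0%N 0%N)) /eqP.
by rewrite !fcoefD !fcoef1.
Qed.

Lemma yvar_neq0 : yvar != 0.
Proof.
by apply/eqP => /(congr1 (fun f : fps2 => f 0%N 1%N)) /eqP; rewrite oner_eq0.
Qed.

Lemma one_series_neq0 (f : fps2) : f 0%N = 1 -> f != 0.
Proof.
move=> f0; apply/eqP => f00; move/eqP: f0.
by rewrite f00 fcoef0 eq_sym oner_eq0.
Qed.

Lemma one_series_subx_neq0 (D f : fps2) : D 0%N = 1 -> D - xvar * f != 0.
Proof.
by move=> D0; apply: one_series_neq0; rewrite fcoefB fpsXM0 D0 subr0.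
Qed.

(** * Weighted lattice paths

  A path is described by its numbers [m] of up steps and [p] of down steps so
  far.  It is at height m - p. *)

(** The distance of the height m - p to {0, 1}. *)
Definition level (m p : nat) : nat :=
  (if p < m then m - p.+1 else p - m)%N.
(** Steps between the heights 0 and 1. *)
Definition inside m p (x : bool) : bool := if x then m == p else m == p.+1.
(** Steps that decrease the level. *)
Definition inward m p (x : bool) : bool :=
  if x then (m < p)%N else (p.+1 < m)%N.

Section Walks.
Variables (A : comNzRingType) (al be ga mu : A).

Definition step_weight m p x (last : bool) : A :=
  if inside m p x then al
  else if inward m p x then (if last then mu else ga) else be.

(** Paths that do not end at height 0 or 1 get weight 0. *)
Fixpoint walk_weight m p (b : seq bool) : A :=
  if b is x :: b' then
    step_weight m p x (nilp b') * walk_weight (m + x)%N (p + ~~ x)%N b'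
  else (p <= m <= p.+1)%:R.

(** The reflection h |-> 1 - h exchanges the two ways to be at a given level and
  preserves the weights, so the level alone determines the total weight of the
  continuations of length [n].  The term with mu - ga corrects the weight of an
  inward last step, which is the step from level 1 to level 0. *)
Fixpoint level_coef n k : A :=
  match n, k with
  | 0, _ => (k == 0%N)%:R
  | n.+1, 0 => al * level_coef n 0 + be * level_coef n 1
  | n.+1, k.+1 => ga * level_coef n k + be * level_coef n k.+2
                  + ((n == 0%N) && (k == 0%N))%:R * (mu - ga)
  end.

Definition level_gf k : fps A := Fps (fun n => level_coef n k).

Lemma sum_tuple_cons n (F : seq bool -> A) :
  \sum_(b : n.+1.-tuple bool) F b =
  \sum_(b : n.-tuple bool) F (true :: b)
  + \sum_(b : n.-tuple bool) F (false :: b).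
Proof.
pose h (q : bool * n.-tuple bool) : n.+1.-tuple bool := [tuple of q.1 :: q.2].
rewrite (reindex h) /=; last first.
  exists (fun b : n.+1.-tuple bool => (thead b, [tuple of behead b])).
    by move=> [x b] _; rewrite /h theadE /=; congr (_, _); apply: val_inj.
  by move=> b _; apply: val_inj; case/tupleP: b.
by rewrite -(pair_big xpredT xpredT (fun x (b : n.-tuple bool) => F (x :: b)))
  /= big_bool.
Qed.

Lemma sum_tuple0 (F : seq bool -> A) : \sum_(b : 0.-tuple bool) F b = F [::].
Proof.
rewrite (eq_bigr (fun=> F [::])) => [|b _]; last by rewrite tuple0.
by rewrite sumr_const card_tuple expn0.
Qed.

Lemma sum_walk_weight n m p :
  \sum_(b : n.-tuple bool) walk_weight m p b = level_coef n (level m p).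
Proof.
elim: n m p => [|n IH] m p.
  rewrite sum_tuple0 /= /level; congr _%:R.
  by case: ltnP; lia.
have red x : \sum_(b : n.-tuple bool) walk_weight m p (x :: b)
    = step_weight m p x (n == 0%N)
      * level_coef n (level (m + x)%N (p + ~~ x)%N).
  rewrite -IH big_distrr; apply: eq_bigr => b _ /=.
  by rewrite /nilp size_tuple.
rewrite (sum_tuple_cons n (walk_weight m p)) !red /= addn1 !addn0 addn1.
(* A path ends at level 0, so a last inward step has k = 0. *)
have inwardE k : (if n == 0%N then mu else ga) * level_coef n k =
    ga * level_coef n k + ((n == 0%N) && (k == 0%N))%:R * (mu - ga).
  case: n {IH red} => [|n] /=; last by rewrite mul0r addr0.
  by case: k => [|k] /=; ring.
rewrite /step_weight /inside /inward /level /=.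
case: (ltngtP p m) => [pm|mp|->].
- case: (eqVneq m p.+1) => [->|mp1].
    by rewrite ltnn ltnS leqnSn subnn subSnn /= addrC.
  have [k ->] : exists k, m = (p + k).+2 by exists (m - p.+2)%N; lia.
  have -> : (p < (p + k).+3)%N by lia.
  have -> : (p.+1 < (p + k).+2)%N by lia.
  have -> : ((p + k).+3 - p.+1 = k.+2)%N by lia.
  have -> : ((p + k).+2 - p.+2 = k)%N by lia.
  have -> : ((p + k).+2 - p.+1 = k.+1)%N by lia.
  by rewrite inwardE /=; ring.
- have [k ->] : exists k, p = (m + k).+1 by exists (p - m.+1)%N; lia.
  have -> : (m == (m + k).+2) = false by lia.
  have -> : ((m + k).+2 < m)%N = false by lia.
  have -> : ((m + k).+1 < m.+1)%N = false by lia.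
  have -> : ((m + k).+1 - m.+1 = k)%N by lia.
  have -> : ((m + k).+2 - m = k.+2)%N by lia.
  have -> : ((m + k).+1 - m = k.+1)%N by lia.
  by rewrite inwardE /=; ring.
- have -> : (m == m.+1) = false by lia.
  have -> : (m.+1 < m)%N = false by lia.
  by rewrite ltnSn subnn subSnn /= subnn.
Qed.

Lemma level_gf0 : level_gf 0 =
  1 + fpsX A * (fpsC al * level_gf 0 + fpsC be * level_gf 1).
Proof.
apply: fpsP => -[|n]; rewrite fcoefD fcoef1; first by rewrite fpsXM0 addr0.
by rewrite fpsXMS add0r fcoefD !fpsCM.
Qed.

(** With B_0 = (mu - ga) + ga G_0 and B_k = ga G_k for k > 0, the system reads
  G_(k+1) = x (B_k + be G_(k+2)), and D G_(k+1) - x B_k is a contracting family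
  because D^2 = D - x^2 be ga. *)
Lemma level_gf_closed (D : fps A) : D 0%N = 1 ->
  D ^+ 2 = D - fpsX A ^+ 2 * fpsC be * fpsC ga ->
  D * level_gf 1 = fpsX A * (fpsC (mu - ga) + fpsC ga * level_gf 0).
Proof.
move=> D0 D2.
pose B k := (if k is 0 then fpsC (mu - ga) else 0) + fpsC ga * level_gf k.
have rec k : level_gf k.+1 = fpsX A * (B k + fpsC be * level_gf k.+2).
  apply: fpsP => -[|n]; first by rewrite fpsXM0.
  rewrite fpsXMS fcoefD fpsCM.
  rewrite /B; case: k => [|k]; rewrite fcoefD fpsCM /= ?andbF ?andbT.
    by case: n => [|n] /=; ring.
  by rewrite mul0r addr0 add0r.
have H0 := @fps_contraction A D (fun k => D * level_gf k.+1 - fpsX A * B k)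
   (fpsC be) D0 _ 0.
apply/eqP; rewrite -subr_eq0; apply/eqP; apply: H0 => k.
have -> : B k.+1 = fpsC ga * level_gf k.+1 by rewrite /B add0r.
have -> : D * (D * level_gf k.+1 - fpsX A * B k) =
  D ^+ 2 * level_gf k.+1 - D * (fpsX A * B k) by ring.
rewrite D2.
have -> : fpsX A * B k =
  level_gf k.+1 - fpsX A * fpsC be * level_gf k.+2.
  by rewrite [in RHS]rec; ring.
ring.
Qed.
End Walks.

Lemma level_step m p x : (level m p + ~~ (inside m p x || inward m p x) =
  level (m + x) (p + ~~ x) + inward m p x)%N.
Proof.
rewrite /level /inside /inward.
case: x; rewrite /= ?addn0 ?addn1; do ?[case: ltnP => ?];
  by do ?[case: eqP => ? /=]; lia.
Qed.
Lemma level_inside m p x : inside m p x -> level m p = 0%N.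
Proof. by rewrite /level /inside; case: x => /eqP->; case: ltnP; lia. Qed.

(** * Faro words as fillings of slots *)

Section Slots.
Local Open Scope nat_scope.

(** Numbered from 1: these are the values whose letter in [b] is [x]. *)
Definition positions (x : bool) (b : seq bool) : seq nat :=
  [seq i.+1 | i <- iota 0 (size b) & nth (~~ x) b i == x].

Definition balanced (b : seq bool) : bool :=
  count_mem false b <= count_mem true b <= (count_mem false b).+1.

Definition faro_of (b : seq bool) : seq nat :=
  interlace (positions true b) (positions false b).

(** The letter of w at place [j], numbered from 0, when the values up to
  [size b] have been written; 0 stands for an empty slot. *)
Definition slot (b : seq bool) (j : nat) : nat :=
  nth 0 (positions (~~ odd j) b) j./2.

Definition next_slot (b : seq bool) (x : bool) : nat :=
  if x then (count_mem true b).*2 else (count_mem false b).*2.+1.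

Lemma positions_rcons x b z : positions x (rcons b z) =
  if z == x then rcons (positions x b) (size b).+1 else positions x b.
Proof.
rewrite /positions size_rcons -addn1 iotaD add0n filter_cat map_cat /=.
rewrite nth_rcons ltnn eqxx.
have -> : [seq i <- iota 0 (size b) | nth (~~ x) (rcons b z) i == x] =
          [seq i <- iota 0 (size b) | nth (~~ x) b i == x].
  by apply: eq_in_filter => i; rewrite mem_iota nth_rcons => /andP[_ ->].
by case: (z == x); rewrite /= ?cats1 ?cats0 ?addn1.
Qed.

Lemma size_positions x b : size (positions x b) = count_mem x b.
Proof.
elim/last_ind: b => [|b z IH] //.
rewrite positions_rcons -[in RHS]cats1 count_cat /= -IH.
by case: ifP => _; rewrite ?size_rcons ?addn0 ?addn1.
Qed.

Lemma mem_positions x b i :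
  (i.+1 \in positions x b) = (i < size b) && (nth (~~ x) b i == x).
Proof.
by rewrite mem_map ?mem_filter ?mem_iota ?add0n 1?andbC //; apply: succn_inj.
Qed.

Lemma positions_gt0 x b : 0 \notin positions x b.
Proof. by apply/mapP => -[]. Qed.

Lemma positions_le x b t : t \in positions x b -> t <= size b.
Proof. by case: t => // t; rewrite mem_positions => /andP[]. Qed.

Lemma sorted_positions x b : sorted ltn (positions x b).
Proof.
rewrite sorted_map; apply: sorted_filter; first exact: ltn_trans.
exact: iota_ltn_sorted.
Qed.

Lemma count_true_false b : count_mem true b + count_mem false b = size b.
Proof.
rewrite -(count_predC (pred1 true) b); congr (_ + _).
by apply: eq_count => -[].
Qed.

Lemma slot_gt0 b j : (0 < slot b j) = (j./2 < count_mem (~~ odd j) b).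
Proof.
rewrite /slot -size_positions.
case: (ltnP j./2) => [jb|jb]; last by rewrite nth_default.
rewrite lt0n; apply: contra (positions_gt0 (~~ odd j) b) => /eqP <-.
exact: mem_nth.
Qed.

Lemma slot_le b j : slot b j <= size b.
Proof.
rewrite /slot; case: (ltnP j./2 (size (positions (~~ odd j) b))) => [jb|jb].
  exact/positions_le/mem_nth.
by rewrite nth_default.
Qed.

Lemma slot_rcons b x j :
  slot (rcons b x) j = if j == next_slot b x then (size b).+1 else slot b j.
Proof.
rewrite /slot positions_rcons /next_slot.
have [xj|xj] := eqVneq x (~~ odd j); last first.
  case: eqP => // jE; move: xj; rewrite jE.
  by case: x jE => _; rewrite /= odd_double.
rewrite nth_rcons size_positions -xj.
have -> : (j == if x then (count_mem true b).*2 else (count_mem false b).*2.+1)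
  = (j./2 == count_mem x b).
  by rewrite -{1}(odd_double_half j); case: x xj; case: (odd j) => // _; lia.
case: ltngtP => // jb.
by rewrite nth_default // size_positions ltnW.
Qed.

Lemma slot_next_gt0 b x : (0 < slot b (next_slot b x).+1) =
  inward (count_mem true b) (count_mem false b) x.
Proof.
rewrite slot_gt0 /next_slot /inward; case: x => /=; rewrite ?odd_double /=.
  by rewrite uphalf_double.
by rewrite doubleK.
Qed.

Fixpoint inward_count m p (b : seq bool) : nat :=
  if b is x :: b' then inward m p x + inward_count (m + x) (p + ~~ x) b' else 0.

Fixpoint last_inward m p (b : seq bool) : bool :=
  if b is x :: b' then
    if nilp b' then inward m p x else last_inward (m + x) (p + ~~ x) b'
  else false.

Lemma inward_count_rcons m p b x : inward_count m p (rcons b x) =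
  inward_count m p b + inward (m + count_mem true b) (p + count_mem false b) x.
Proof.
elim: b m p => [|z b IH] m p /=; first by rewrite !addn0.
by rewrite IH !addnA; case: z; rewrite /= ?addn0.
Qed.

Lemma last_inward_rcons m p b x : last_inward m p (rcons b x) =
  inward (m + count_mem true b) (p + count_mem false b) x.
Proof.
elim: b m p => [|z b IH] m p /=; first by rewrite !addn0.
by rewrite /nilp size_rcons /= IH !addnA; case: z; rewrite /= ?addn0.
Qed.

(** Writing a new maximum into slot j creates no descent at j - 1, and one at j
  exactly if slot j + 1 is already filled.  The sum may run over more slots
  than letters since empty slots contribute nothing. *)
Lemma descents_inward_count N b : (size b).*2 <= N ->
  \sum_(j < N) (0 < slot b j.+1 < slot b j) = inward_count 0 0 b.
Proof.
elim/last_ind: b => [|b x IH] bN.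
  by rewrite big1 // => j _; rewrite /slot /= nth_nil.
rewrite size_rcons in bN.
have sN : next_slot b x < N.
  move: bN (count_true_false b); rewrite /next_slot.
  by move: (count_mem true b) (count_mem false b); case: x => /=; lia.
have sx : slot b (next_slot b x) = 0.
  apply/eqP; rewrite -leqn0 leqNgt slot_gt0 /next_slot.
  by case: x {sN} => /=; rewrite ?odd_double ?doubleK ?uphalf_double ltnn.
rewrite inward_count_rcons !add0n -slot_next_gt0 -IH; last by lia.
rewrite (bigD1 (Ordinal sN)) //= [in RHS](bigD1 (Ordinal sN)) //= sx ltn0 andbF.
rewrite add0n addnC; congr (_ + _).
  apply: eq_bigr => j /eqP jn.
  have jn' : (j == next_slot b x :> nat) = false.
    by apply/negbTE/eqP => jE; apply: jn; apply: val_inj.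
  rewrite !slot_rcons jn'; case: eqP => // -> /=.
  rewrite sx ltnn /= ltnNge (leq_trans (slot_le _ _)) //.
rewrite !slot_rcons eqxx; case: eqP; first lia.
by move=> _; rewrite ltnS slot_le andbT.
Qed.

Lemma size_interlace u v : size (interlace u v) = size u + size v.
Proof.
elim: u v => [|a u IH] [|c v] //=; first by rewrite addn0.
by rewrite IH addnS.
Qed.

Lemma perm_interlace u v : perm_eq (interlace u v) (u ++ v).
Proof.
elim: u v => [|a u IH] [|c v] //=; first by rewrite cats0.
rewrite perm_cons perm_sym -cat1s perm_catCA /= perm_cons perm_sym.
exact: IH.
Qed.

Lemma nth_interlace d u v j : size v <= size u <= (size v).+1 ->
  nth d (interlace u v) j = nth d (if odd j then v else u) j./2.
Proof.
elim: u v j => [|a u IH] [|c v] j //=.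
- by rewrite nth_nil if_same nth_nil.
- case: u {IH} => // _; case: j => [|[|j]] //=; rewrite ?nth_nil //.
  by case: (odd j); rewrite /= ?nth_nil.
rewrite !ltnS => uv; case: j => [|[|j]] //=.
by rewrite IH // negbK; case: (odd j).
Qed.

Lemma nth_faro_of b j : balanced b -> nth 0 (faro_of b) j = slot b j.
Proof.
move=> bb; rewrite nth_interlace ?size_positions // /slot.
by case: (odd j).
Qed.

Lemma size_faro_of b : size (faro_of b) = size b.
Proof. by rewrite size_interlace !size_positions count_true_false. Qed.

End Slots.

(** * Occurrences of the patterns *)

Section Occurrences.
Local Open Scope nat_scope.

(** A form of order isomorphism that computes on explicit patterns. *)
Lemma order_isoE s t : order_iso s t = (size s == size t) &&
  all (fun i =>
    all (fun j => (nth 0 s i < nth 0 s j) == (nth 0 t i < nth 0 t j))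
      (iota 0 (size s))) (iota 0 (size s)).
Proof.
congr (_ && _); apply/forallP/allP => [st i|st i].
  rewrite mem_iota => /andP[_ iS]; apply/allP => j.
  rewrite mem_iota => /andP[_ jS].
  by have /forallP/(_ (Ordinal jS)) := st (Ordinal iS).
have inI (k : 'I_(size s)) : (k : nat) \in iota 0 (size s).
  by rewrite mem_iota ltn_ord.
by apply/forallP => j; apply: (allP (st _ (inI i))).
Qed.

Lemma occurrencesE p s : 0 < size p -> occurrences p s =
  \sum_(i < (size s).+1 - size p)
     order_iso [seq nth 0 s (i + j) | j <- iota 0 (size p)] p.
Proof.
move=> p0; rewrite /occurrences.
rewrite -(big_mkord xpredT
  (fun i => order_iso (take (size p) (drop i s)) p : nat)).
rewrite (big_cat_nat (leq0n _) (leq_subr (size p) _)) //= big_mkord.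
rewrite [X in _ + X]big_nat [X in _ + X]big1 ?addn0; last first.
  move=> i /andP[iS _]; rewrite /order_iso size_take_min size_drop.
  by case: eqP => //=; lia.
apply: eq_bigr => i _; congr (order_iso _ _ : nat).
apply: (@eq_from_nth _ 0).
  by rewrite size_take_min size_drop size_map size_iota; have := ltn_ord i; lia.
move=> j; rewrite size_take_min leq_min => /andP[jp _].
by rewrite nth_take // nth_drop (nth_map 0) ?size_iota // nth_iota.
Qed.

Definition first_down (b : seq bool) : bool := ohead b == Some false.

Section FaroStatistics.
Variable b : seq bool.
Hypothesis bal : balanced b.

Lemma slot_gt0_balanced j : (0 < slot b j) = (j < size b).
Proof.
rewrite slot_gt0 -(count_true_false b); move: bal; rewrite /balanced.
have := odd_double_half j.
by case: (odd j) => /=; move: (count_mem true b) (count_mem false b); lia.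
Qed.

Lemma slot_lt2 j : j.+2 < size b -> slot b j < slot b j.+2.
Proof.
rewrite -slot_gt0_balanced slot_gt0 /slot /= negbK => jb.
apply: (sorted_ltn_nth ltn_trans 0 (sorted_positions _ _)) => //;
  by rewrite inE size_positions // ltnW.
Qed.

Lemma slot_mem j : j < size b -> slot b j \in positions (~~ odd j) b.
Proof.
by rewrite -slot_gt0_balanced slot_gt0 -size_positions; apply: mem_nth.
Qed.

Lemma slot_neqS j : j.+1 < size b -> slot b j != slot b j.+1.
Proof.
move=> jb; have := slot_mem jb; have := slot_mem (ltnW jb).
case: eqP => // <- /=; case: (slot b j) => [|t].
  by rewrite (negbTE (positions_gt0 _ _)).
rewrite !mem_positions => /andP[tb /eqP tj] /andP[_ /eqP].
by rewrite (set_nth_default (~~ ~~ odd j)) // tj negbK; case: (odd j).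
Qed.

Lemma descents_faro_of :
  \sum_(j < (size b).-1) (slot b j.+1 < slot b j) = inward_count 0 0 b.
Proof.
rewrite -(descents_inward_count (leqnn _)).
rewrite -(big_mkord xpredT (fun j => slot b j.+1 < slot b j : nat)).
rewrite -(big_mkord xpredT (fun j => 0 < slot b j.+1 < slot b j : nat)).
have le : (size b).-1 <= (size b).*2 by lia.
rewrite [RHS](big_cat_nat (leq0n _) le) //= [X in _ = _ + X]big_nat.
rewrite [X in _ = _ + X]big1 ?addn0.
  apply: eq_big_nat => j /andP[_ jb]; rewrite slot_gt0_balanced.
  by have -> : j.+1 < size b by lia.
move=> j /andP[jb _]; rewrite slot_gt0_balanced.
by have -> : (j.+1 < size b) = false by lia.
Qed.

(** The value 1 occupies slot 1, and not slot 0, if the first step goes down. *)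
Lemma first_descent : 1 < size b -> (slot b 1 < slot b 0) = first_down b.
Proof.
move=> b1; have := slot_neqS b1; have := slot_gt0_balanced 0.
have := slot_gt0_balanced 1; rewrite b1 (ltnW b1) /first_down /slot /=.
case: b b1 => [|x b'] //= _.
rewrite (_ : (Some x == Some false) = ~~ x); last by case: x.
by case: x => /=; move: (nth 0 _ 0) => t; lia.
Qed.

(** The maximum occupies one of the last two slots, and the last comparison is a
  descent exactly if it occupies the first of them. *)
Lemma last_descent : 1 < size b ->
  (slot b (size b).-1 < slot b (size b).-2) = last_inward 0 0 b.
Proof.
move: bal; case/lastP: b => [|b' x] //.
rewrite /balanced last_inward_rcons !add0n size_rcons ltnS /= -cats1 !count_cat.
rewrite cats1 !slot_rcons -(count_true_false b') /=.
have := slot_le b' (size b').-1; have := slot_le b' (size b').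
rewrite -(count_true_false b') /next_slot /inward.
move: (count_mem true b') (count_mem false b') => m p.
move: (slot b' (m + p)) (slot b' (m + p).-1) => s t.
by case: x => /=; case: eqP => ?; case: eqP => ?; lia.
Qed.

(** A window of length 3 starts with the smaller of its first and third letters,
  so its pattern is 132, 213 or 123 according to which of its two comparisons,
  if any, is a descent.  The identities are additive, and n - 1 and n - 2 are
  truncated, so that they also hold for n < 2. *)
Lemma faro_statistics (d := inward_count 0 0 b) (l := last_inward 0 0 b) :
  [/\ occurrences [:: 2; 1] (faro_of b) = d,
      occurrences [:: 1; 2] (faro_of b) + d = (size b).-1,
      occurrences [:: 1; 3; 2] (faro_of b) + first_down b = d,
      occurrences [:: 2; 1; 3] (faro_of b) + l = d
    & occurrences [:: 1; 2; 3] (faro_of b) + d.*2 =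
      size b - 2 + first_down b + l].
Proof.
have [small|] := leqP (size b) 1.
  have d0 : d = 0.
    rewrite /d -descents_faro_of.
    by case: (size b) small => [|[|]] // _; rewrite big_ord0.
  have f0 : first_down b = false.
    rewrite /first_down.
    by move: bal small; rewrite /balanced; case: b => [|[] [|]].
  have l0 : l = false.
    by rewrite /l; move: bal small; rewrite /balanced; case: b => [|[] [|]].
  rewrite d0 f0 l0 !occurrencesE //= !size_faro_of.
  by case: (size b) small => [|[|]] // _;
    rewrite !subSS ?subn0 ?sub0n !big_ord0.
have wE i j : nth 0 (faro_of b) (i + j) = slot b (i + j) by exact: nth_faro_of.
move=> b1; have := descents_faro_of.
have := first_descent b1; have := last_descent b1.
rewrite -/d -/l !occurrencesE //= !size_faro_of.
have lt2 := slot_lt2; have ne1 := slot_neqS.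
case: (size b) b1 lt2 ne1 => [|[|k]] // _ lt2 ne1 /= lE fE dE.
rewrite !subSS !subn0.
pose D j : nat := slot b j.+1 < slot b j.
have {}dE : d = \sum_(j < k.+1) D j by rewrite -dE.
have dl : d = first_down b + \sum_(j < k) D j.+1.
  by rewrite dE big_ord_recl -fE.
have dr : d = \sum_(j < k) D j + l by rewrite dE big_ord_recr -lE.
split.
- rewrite dE; apply: eq_bigr => i _.
  by rewrite !wE order_isoE /= addn0 addn1 !ltnn /D; case: ltngtP.
- rewrite dE -big_split /= -[RHS]card_ord -sum1_card; apply: eq_bigr => i _.
  rewrite !wE order_isoE /= addn0 addn1 !ltnn /D.
  by have := ne1 i; have := ltn_ord i; case: ltngtP; lia.
- rewrite dl addnC; congr (_ + _); apply: eq_bigr => i _.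
  rewrite !wE order_isoE /= addn0 addn1 addn2 !ltnn /D.
  by have := lt2 i; have := ltn_ord i; lia.
- rewrite dr; congr (_ + _); apply: eq_bigr => i _.
  rewrite !wE order_isoE /= addn0 addn1 addn2 !ltnn /D.
  by have := lt2 i; have := ltn_ord i; lia.
set o := (X in X + _).
suff: o + \sum_(j < k) D j.+1 + \sum_(j < k) D j = k by lia.
rewrite -!big_split /= -[RHS]card_ord -sum1_card; apply: eq_bigr => i _.
rewrite !wE order_isoE /= addn0 addn1 addn2 !ltnn /D.
have := lt2 i; have := ne1 i; have := ne1 i.+1; have := ltn_ord i.
by case: ltngtP; case: ltngtP; lia.
Qed.

End FaroStatistics.

End Occurrences.

(** * Faro permutations and balanced words *)

Section Bijection.
Local Open Scope nat_scope.

Definition parity_word n (w : 'S_n) : n.-tuple bool :=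
  [tuple ~~ odd ((w^-1)%g i) | i < n].

Lemma size_one_line n (w : 'S_n) : size (one_line w) = n.
Proof. by rewrite size_map size_enum_ord. Qed.

Lemma nth_one_line n (w : 'S_n) (i : 'I_n) : nth 0 (one_line w) i = (w i).+1.
Proof.
rewrite /one_line (nth_map i); last by rewrite size_enum_ord.
by rewrite nth_ord_enum.
Qed.

Lemma one_line_inj n : injective (@one_line n).
Proof.
move=> w w' E; apply/permP => i; apply/val_inj/succn_inj.
by rewrite -!nth_one_line E.
Qed.

Lemma mem_positions_parity n (w : 'S_n) x (j : 'I_n) :
  ((w j).+1 \in positions x (parity_word w)) = (~~ odd j == x).
Proof.
rewrite mem_positions size_tuple ltn_ord /=.
by rewrite -[nat_of_ord (w j)]/(val (w j)) (nth_mktuple _ (~~ x)) permK.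
Qed.

(** Sorted lists with the same elements are equal, so u and v are determined by
  the parities of the places of their elements. *)
Lemma positions_parity_word n (w : 'S_n) u v :
  sorted ltn u -> sorted ltn v -> size v <= size u <= (size v).+1 ->
  one_line w = interlace u v ->
  forall x, positions x (parity_word w) = if x then u else v.
Proof.
move=> su sv suv E x; set s := if x then u else v.
have szE : size u + size v = n by rewrite -size_interlace -E size_one_line.
have nthE (j : 'I_n) : (w j).+1 = nth 0 (if odd j then v else u) j./2.
  by rewrite -nth_one_line E nth_interlace.
apply: (irr_sorted_eq ltn_trans ltnn (sorted_positions _ _)).
  by rewrite /s; case: (x).
move=> t; apply/idP/idP => [|ts].
  case: t => [|t tpos]; first by rewrite (negbTE (positions_gt0 _ _)).
  have tn : t < n by have := positions_le tpos; rewrite size_tuple.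
  have jE : w ((w^-1)%g (Ordinal tn)) = Ordinal tn by rewrite permKV.
  move: jE; set j := (w^-1)%g _ => jE.
  have tE : (w j).+1 = t.+1 by rewrite jE.
  move: tpos; rewrite /s -tE mem_positions_parity nthE => /eqP <-.
  have -> : (if ~~ odd j then u else v) = if odd j then v else u.
    by case: (odd j).
  (* The place j lies below n = size u + size v. *)
  apply: mem_nth; have := odd_double_half j; have := ltn_ord j.
  by case: (odd j) => /=; lia.
have sz : index t s < size s by rewrite index_mem.
have jn : (index t s).*2 + ~~ x < n.
  by move: sz; rewrite /s; case: (x) => /=; lia.
have := nthE (Ordinal jn); rewrite /=.
have -> : odd ((index t s).*2 + ~~ x) = ~~ x.
  by rewrite oddD odd_double; case: (x).
have -> : ((index t s).*2 + ~~ x)./2 = index t s by case: (x); lia.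
rewrite if_neg -/s nth_index // => <-.
by rewrite mem_positions_parity /= oddD odd_double; case: (x).
Qed.

Lemma faro_word_parity n (w : 'S_n) : faro_word (one_line w) ->
  balanced (parity_word w) /\ one_line w = faro_of (parity_word w).
Proof.
move=> [u [v [su sv suv E]]]; have pE := positions_parity_word su sv suv E.
rewrite /balanced -!size_positions /faro_of.
by rewrite (pE true) (pE false).
Qed.

Lemma faro_of_faro b : balanced b -> faro_word (faro_of b).
Proof.
move=> bb; exists (positions true b), (positions false b).
by rewrite !sorted_positions !size_positions.
Qed.

Lemma positions_inj b b' : size b = size b' ->
  positions true b = positions true b' -> b = b'.
Proof.
move=> sz pE; apply: (@eq_from_nth _ false) => // i ib.
have : (i.+1 \in positions true b) = (i.+1 \in positions true b') by rewrite pE.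
by rewrite !mem_positions -sz ib /= !eqb_id.
Qed.

Lemma faro_of_perm n (b : n.-tuple bool) : balanced b ->
  exists2 w : 'S_n, one_line w = faro_of b & parity_word w = b.
Proof.
move=> bb; have sz : size (faro_of b) = n by rewrite size_faro_of size_tuple.
have uq : uniq (faro_of b).
  rewrite (perm_uniq (perm_interlace _ _)) cat_uniq.
  rewrite !(sorted_uniq ltn_trans ltnn (sorted_positions _ _)) andbT /=.
  apply/hasPn => -[|t]; first by rewrite (negbTE (positions_gt0 _ _)).
  rewrite !mem_positions => /andP[tb /eqP tf]; rewrite tb /=.
  by rewrite (set_nth_default true) // tf.
have rg (j : 'I_n) : 0 < nth 0 (faro_of b) j <= n.
  rewrite nth_faro_of // slot_gt0_balanced // size_tuple ltn_ord /=.
  by rewrite -[X in _ <= X](size_tuple b) slot_le.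
have rg' (j : 'I_n) : (nth 0 (faro_of b) j).-1 < n by have := rg j; lia.
have fI : injective (fun j => Ordinal (rg' j)).
  move=> i j [/(congr1 succn)]; have := rg i; have := rg j.
  move=> /andP[j0 _] /andP[i0 _]; rewrite !prednK // => E.
  apply/val_inj/eqP; rewrite -(nth_uniq 0 _ _ uq) ?sz ?ltn_ord //.
  exact/eqP.
have E : one_line (perm fI) = faro_of b.
  apply: (@eq_from_nth _ 0) => [|j]; rewrite size_one_line ?sz // => jn.
  have := nth_one_line (perm fI) (Ordinal jn); rewrite /= => ->.
  by rewrite permE /= prednK //; have /andP[] := rg (Ordinal jn).
exists (perm fI) => //; apply: val_inj; apply: positions_inj.
  by rewrite !size_tuple.
by rewrite (positions_parity_word _ _ _ E) ?sorted_positions ?size_positions.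
Qed.

End Bijection.

Lemma faro_gfE p n : faro_gf p n =
  \sum_(b : n.-tuple bool | balanced b) fpsX rat ^+ occurrences p (faro_of b).
Proof.
pose P := [set w : 'S_n | `[< faro_word (one_line w) >]].
have -> : faro_gf p n = \sum_(w in P) fpsX rat ^+ occurrences p (one_line w).
  apply: fpsP => k.
  rewrite (big_morph (fun f : fps rat => f k) (fun f g => fcoefD f g k)
    (fcoef0 _ k)) /= /faro_count -sum1_card natr_sum.
  rewrite big_mkcond [RHS]big_mkcond; apply: eq_bigr => w _.
  rewrite !inE coef_fpsXn [k == _]eq_sym.
  by case: `[< _ >]; case: eqP.
have inP w : w \in P -> balanced (parity_word w) /\
    one_line w = faro_of (parity_word w).
  by rewrite inE => /asboolP; apply: faro_word_parity.
rewrite (eq_bigr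
  (fun w => fpsX rat ^+ occurrences p (faro_of (parity_word w))));
  last by move=> w /inP[_ <-].
rewrite -(big_imset (fun b : n.-tuple bool =>
  fpsX rat ^+ occurrences p (faro_of b))) /=; last first.
  move=> w w' /inP[_ E] /inP[_ E'] ww'; apply: one_line_inj.
  by rewrite E E' ww'.
apply: eq_bigl => b; apply/imsetP/idP => [[w /inP[bw _] ->] //|bb].
have [w E wb] := faro_of_perm bb; exists w => //.
by rewrite inE E; apply/asboolP/faro_of_faro.
Qed.

(** * Weights of balanced words *)

Section WordWeight.
Variables (A : comNzRingType) (al be nu ga mu : A).
Local Notation walk_weight := (walk_weight al be ga mu).

Lemma last_inward_le m p b : (last_inward m p b <= inward_count m p b)%N.
Proof.
elim: b m p => [|x b IH] m p //=.
case: nilP => [->|_]; first by rewrite /= addn0.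
by rewrite (leq_trans (IH _ _)) ?leq_addl.
Qed.

(** [a] and [o] count the inside and the outward steps; a path that ends at level
  0 makes as many inward steps as outward ones, plus its initial level. *)
Lemma walk_weightE m p b (i := inward_count m p b) (l := last_inward m p b) :
  if (p + count_mem false b <= m + count_mem true b
        <= (p + count_mem false b).+1)%N
  then exists a o, [/\ (a + o + i = size b)%N, (i = level m p + o)%N &
         walk_weight m p b = al ^+ a * be ^+ o * ga ^+ (i - l) * mu ^+ l]
  else walk_weight m p b = 0.
Proof.
rewrite {}/i {}/l; elim: b m p => [|x b IH] m p /=.
  rewrite !addn0; case: ifPn => [end0|/negbTE-> //].
  exists 0%N, 0%N; split=> //.
    by move: end0; rewrite /level; case: ltnP; lia.
  by rewrite end0 !expr0 !mulr1.
have := IH (m + x)%N (p + ~~ x)%N.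
have -> : (p + ((x == false) + count_mem false b) =
           p + ~~ x + count_mem false b)%N by case: x; rewrite /= ?addn0 ?addnA.
have -> : (m + ((x == true) + count_mem true b) =
           m + x + count_mem true b)%N by case: x; rewrite /= ?addn0 ?addnA.
case: ifP => [_|_ ->]; last by rewrite mulr0.
have := last_inward_le (m + x) (p + ~~ x) b.
move=> li [a [o [szE iE ->]]].
have stepE := level_step m p x; rewrite /step_weight.
have [ins|nins] := boolP (inside m p x).
  have lvl0 := level_inside ins.
  have ninw : inward m p x = false.
    by move: ins; rewrite /inside /inward; case: (x) => /eqP->; lia.
  exists a.+1, o; rewrite ninw add0n.
  have -> : (if nilp b then false else last_inward (m + x) (p + ~~ x) b) =
    last_inward (m + x) (p + ~~ x) b by case: (b).
  split; [lia | by move: stepE; rewrite ninw ins lvl0 iE; lia|].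
  by rewrite exprS !mulrA.
have [inw|ninw] := boolP (inward m p x).
  exists a, o; rewrite add1n; split; [lia | |].
    by move: stepE; rewrite inw orbT iE; lia.
  case: nilP li => [-> _|_ li] /=; first by ring.
  by rewrite subSn // exprS; ring.
exists a, o.+1; rewrite add0n.
have -> : (if nilp b then false else last_inward (m + x) (p + ~~ x) b) =
    last_inward (m + x) (p + ~~ x) b by case: (b).
split; [lia| move: stepE; rewrite (negbTE nins) (negbTE ninw) iE /=; lia|].
by rewrite exprS; ring.
Qed.

(** From height 0 an up first step is inside, a down one is outward. *)
Definition word_weight (b : seq bool) : A :=
  match b with
  | [::] => 1
  | true :: b' => al * walk_weight 1 0 b'
  | false :: b' => nu * walk_weight 0 1 b'
  end.

Lemma word_weightE b (d := inward_count 0 0 b) (f := first_down b)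
    (l := last_inward 0 0 b) :
  word_weight b =
  if balanced b then
    al ^+ (size b - d.*2) * be ^+ (d - f) * nu ^+ f * ga ^+ (d - l) * mu ^+ l
  else 0.
Proof.
rewrite {}/d {}/f {}/l; case: b => [|x b].
  by rewrite /= !expr0 !mulr1.
have lE : last_inward 0 0 (x :: b) = last_inward x (~~ x) b.
  by rewrite /= !add0n; case: x; case: b.
rewrite lE {lE} /balanced /first_down /=.
have /= := walk_weightE x (~~ x) b.
have -> : ((x == false) + count_mem false b = ~~ x + count_mem false b)%N.
  by case: x.
have -> : ((x == true) + count_mem true b = x + count_mem true b)%N by case: x.
have -> : inward 0 0 x = false by case: x.
rewrite !add0n; move: (last_inward _ _ _) (inward_count _ _ _) => l i.
case: ifP => [_ [a [o [szE iE wE]]]|_ wE]; last first.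
  by case: x wE => /= ->; rewrite mulr0.
rewrite -szE; case: x iE wE => /= iE ->.
  have -> : ((a + o + i).+1 - i.*2 = a.+1)%N by rewrite iE /level /=; lia.
  have -> : (i - false = o)%N by rewrite iE /level /= subn0.
  by rewrite exprS expr0 mulr1 !mulrA.
have -> : ((a + o + i).+1 - i.*2 = a)%N by rewrite iE /level /=; lia.
have -> : (i - true = o)%N by rewrite iE /level /=; lia.
by rewrite expr1 -!mulrA; ring.
Qed.

Definition word_gf : fps A :=
  Fps (fun n => \sum_(b : n.-tuple bool) word_weight b).

Lemma word_gfE : word_gf = 1 + fpsX A *
  (fpsC al * level_gf al be ga mu 0 + fpsC nu * level_gf al be ga mu 1).
Proof.
apply: fpsP => -[|n]; rewrite fcoefD fcoef1.
  by rewrite fpsXM0 addr0 /= (sum_tuple0 word_weight).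
rewrite fpsXMS add0r fcoefD !fpsCM /= sum_tuple_cons /= -!big_distrr /=.
by rewrite !sum_walk_weight.
Qed.

End WordWeight.

(** * The five specializations *)

Section ClosedForm.
Variables (A : comNzRingType) (al be nu ga mu : A).
Variable D : fps A.
Hypothesis D0 : D 0%N = 1.
Hypothesis D2 : D ^+ 2 = D - fpsX A ^+ 2 * fpsC (be * ga).
Local Notation x := (fpsX A).
Local Notation F := (word_gf al be nu ga mu).
Local Notation G0 := (level_gf al be ga mu 0).
Local Notation G1 := (level_gf al be ga mu 1).

Lemma level_gf1_closed : D * G1 = x * (fpsC (mu - ga) + fpsC ga * G0).
Proof. by apply: level_gf_closed => //; rewrite D2 rmorphM mulrA. Qed.

Lemma level_gf0_closed :
  D * (G0 * (D - x * fpsC al)) = D + x ^+ 2 * fpsC (be * (mu - ga)).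
Proof.
have -> : D * (G0 * (D - x * fpsC al)) = G0 * D ^+ 2 - x * fpsC al * (D * G0).
  by ring.
have -> : G0 * D ^+ 2 = D * G0 - x ^+ 2 * fpsC (be * ga) * G0.
  by rewrite D2; ring.
have E : D * G0 = D + x * fpsC al * (D * G0) + x * fpsC be * (D * G1).
  by rewrite {1}level_gf0; ring.
rewrite level_gf1_closed in E; rewrite {1}E !rmorphM; ring.
Qed.

End ClosedForm.

Section Weights.
Local Notation y := (fpsX rat).

Lemma faro_gf_coef p n c (al be nu ga mu : fps rat) :
  (forall b, size b = n -> balanced b ->
     c * y ^+ occurrences p (faro_of b) = word_weight al be nu ga mu b) ->
  c * faro_gf p n = word_gf al be nu ga mu n.
Proof.
move=> wE; rewrite faro_gfE big_mkcond big_distrr; apply: eq_bigr => b _ /=.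
case: ifPn => [/wE-> //|nb]; first by rewrite size_tuple.
by rewrite word_weightE (negbTE nb) mulr0.
Qed.

Lemma faro_gf_word p (al be nu ga mu : fps rat) :
  (forall b, balanced b ->
     y ^+ occurrences p (faro_of b) = word_weight al be nu ga mu b) ->
  faro_gf p = word_gf al be nu ga mu.
Proof.
move=> wE; apply: fpsP => n; rewrite -[LHS]mul1r; apply: faro_gf_coef => b _ bb.
by rewrite mul1r wE.
Qed.

Lemma faro_gf_small p n : (n <= 1 < size p)%N -> faro_gf p n = 1.
Proof.
move=> /andP[n1 p1]; rewrite faro_gfE (eq_bigr (fun=> 1)) => [|b _].
  rewrite big_mkcond; case: n n1 => [_|[_|//]].
    by rewrite (sum_tuple0 (fun b => if balanced b then 1 else 0)).
  rewrite (sum_tuple_cons 0 (fun b => if balanced b then 1 else 0)).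
  rewrite (sum_tuple0 (fun b => if balanced (true :: b) then 1 else 0)).
  rewrite (sum_tuple0 (fun b => if balanced (false :: b) then 1 else 0)).
  by rewrite /= addr0.
rewrite occurrencesE ?(ltnW p1) // size_faro_of size_tuple.
by rewrite (_ : n.+1 - size p = 0)%N ?big_ord0 ?expr0 //; lia.
Qed.

Lemma first_down_le b : balanced b -> (first_down b <= inward_count 0 0 b)%N.
Proof. by move=> bb; have [_ _ <- _ _] := faro_statistics bb; apply: leq_addl. Qed.

(** Descents are never adjacent; this is the nonnegativity of the number of
  occurrences of 123 in [faro_statistics]. *)
Lemma double_inward_le b : balanced b -> ((inward_count 0 0 b).*2 <= size b)%N.
Proof.
move=> bb; have [_ E1 _ _ E] := faro_statistics bb.
move: E; case: (first_down b); case: (last_inward 0 0 b); lia.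
Qed.

Lemma faro_gf21 : faro_gf [:: 2; 1]%N = word_gf 1 1 1 y y.
Proof.
apply: faro_gf_word => b bb; have [-> _ _ _ _] := faro_statistics bb.
by rewrite word_weightE bb !expr1n !mul1r -exprD subnK ?last_inward_le.
Qed.

(** A permutation of length n > 0 with d descents has n - 1 - d ascents, which is
  why y K_12 appears; the constant term is adjusted separately. *)
Lemma faro_gf12 : fpsC y * faro_gf [:: 1; 2]%N =
  word_gf y y y 1 1 + fpsC (y - 1).
Proof.
apply: fpsP => -[|n]; rewrite fpsCM fcoefD ?fpsC0 ?fpsCS ?addr0.
  by rewrite faro_gf_small // word_gfE fcoefD fpsXM0 fcoef1 /=; ring.
apply: faro_gf_coef => b bn bb; have [_ E _ _ _] := faro_statistics bb.
rewrite word_weightE bb !expr1n !mulr1 -exprS -!exprD; congr (_ ^+ _).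
have := double_inward_le bb; have := first_down_le bb; lia.
Qed.

(** Every descent is the end of a 132, except one at the first position, which is
  there when the first step goes down.  So y is carried by the outward steps, as
  many as the inward ones, and nu = 1 discounts the first step. *)
Lemma faro_gf132 : faro_gf [:: 1; 3; 2]%N = word_gf 1 y 1 1 1.
Proof.
apply: faro_gf_word => b bb; have [_ _ E _ _] := faro_statistics bb.
by rewrite word_weightE bb !expr1n !mulr1 mul1r -E addnK.
Qed.

(** Every descent is the beginning of a 213, except one at the last position,
  which is there when the last step is inward: hence mu = 1. *)
Lemma faro_gf213 : faro_gf [:: 2; 1; 3]%N = word_gf 1 1 1 y 1.
Proof.
apply: faro_gf_word => b bb; have [_ _ _ E _] := faro_statistics bb.
by rewrite word_weightE bb !expr1n !mulr1 !mul1r -E addnK.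
Qed.

(** For n > 1 the number of occurrences is n - 2 - 2d + f + l, whence the factor
  y^2; the lengths 0 and 1 are adjusted separately. *)
Lemma faro_gf123 : fpsC (y ^+ 2) * faro_gf [:: 1; 2; 3]%N =
  word_gf y 1 y 1 y + fpsC (y ^+ 2 - 1) + fpsX _ * fpsC (y ^+ 2 - y).
Proof.
have F0 : word_gf y 1 y 1 y 0%N = 1.
  by rewrite word_gfE fcoefD fpsXM0 fcoef1 addr0.
apply: fpsP => -[|[|n]];
  rewrite fpsCM !fcoefD ?fpsXM0 ?fpsXMS ?fpsC0 ?fpsCS ?addr0.
- by rewrite faro_gf_small // F0; ring.
- rewrite faro_gf_small //.
  by rewrite word_gfE fcoefD fpsXMS fcoefD !fpsCM fcoef1 /= mulr1 mulr0; ring.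
apply: faro_gf_coef => b bn bb; have [_ _ _ _ E] := faro_statistics bb.
rewrite word_weightE bb !expr1n !mulr1 -!exprD; congr (_ ^+ _).
have := double_inward_le bb; rewrite bn subSS subSS subn0 in E *; lia.
Qed.
End Weights.

Theorem theorem3p5 :
  let x := xvar in
  let y := yvar in
  let K p := (faro_gf p)%:F in
  let r := fps_sqrt (1 - 4 * x ^+ 2 * y) in
  let s := fps_sqrt (1 - 4 * x ^+ 2) in
  [/\ K [:: 2; 1]%N = 2%:F / (1 - 2 * x + r)%:F,
      K [:: 1; 2]%N =
        (1 + y + 2 * x * y - 2 * x * y ^+ 2 + (y - 1) * r)%:F
        / (y * (1 - 2 * x * y + r))%:F,
      K [:: 1; 3; 2]%N = K [:: 2; 1; 3]%N,
      K [:: 2; 1; 3]%N =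
        (1 + y + (y - 1) * r)%:F / (y * (1 - 2 * x + r))%:F
    & K [:: 1; 2; 3]%N =
        (2 + 3 * x - 3 * x * y + 2 * x ^+ 2 - 2 * x ^+ 2 * y
           - x * (1 - y) * s)%:F
        / (1 - 2 * x * y + s)%:F].
Proof.
move=> x y K r s.
have xx0 : (x ^+ 2) 0%N = 0 by rewrite expr2 fpsXM0.
have xy0 : (x ^+ 2 * y) 0%N = 0 by rewrite fcoefM0 xx0 mul0r.
have [D [D0 rE D2]] := fps_sqrt_half xy0.
have [B [B0 sE B2]] := fps_sqrt_half xx0.
rewrite mulrA -/r in rE; rewrite -/s in sE.
have xE : fpsX (fps rat) = x by [].
have yE : fpsC (fpsX rat) = y by [].
have y0 := yvar_neq0; have two0 := fps2_two_neq0.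
have Dn0 := one_series_neq0 D0; have Bn0 := one_series_neq0 B0.
have Dx0 : D - x != 0.
  by have := one_series_subx_neq0 1 D0; rewrite mulr1.
have Dxy0 := one_series_subx_neq0 y D0.
have Bxy0 := one_series_subx_neq0 y B0.
have den1 : 1 - 2 * x + r = 2 * (D - x) by rewrite rE; ring.
have den2 : 1 - 2 * x * y + r = 2 * (D - x * y) by rewrite rE; ring.
have den3 : 1 - 2 * x * y + s = 2 * (B - x * y) by rewrite sE; ring.
rewrite /K den1 den2 den3; have nz := (mulf_neq0, two0, y0).
have gf132 : faro_gf [:: 1; 3; 2]%N * (y * (2 * (D - x))) = 1 + y + (y - 1) * r.
  rewrite faro_gf132 word_gfE rE.
  have D2' : D ^+ 2 = D - fpsX _ ^+ 2 * fpsC (fpsX rat * 1) by rewrite mulr1.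
  have := level_gf1_closed 1 1 D0 D2'; have := level_gf0_closed 1 1 D0 D2'.
  rewrite subrr mulr0 !rmorph0 !rmorph1 add0r mulr0 addr0 !mulr1 !mul1r !xE.
  set G0 := level_gf _ _ _ _ 0; set G1 := level_gf _ _ _ _ 1.
  rewrite -[RHS]mulr1 => /(mulfI Dn0) E0 E1; apply: (mulfI Dn0).
  have -> : D * ((1 + x * (G0 + G1)) * (y * (2 * (D - x)))) = 2 * y *
    (D * (D - x) + x * D * (G0 * (D - x)) + x * (D * G1) * (D - x)) by ring.
  have -> : x * (D * G1) * (D - x) = x ^+ 2 * (G0 * (D - x)).
    by rewrite E1; ring.
  by rewrite E0; ring: D2.
have gf213 : faro_gf [:: 2; 1; 3]%N * (y * (2 * (D - x))) = 1 + y + (y - 1) * r.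
  rewrite faro_gf213 word_gfE -level_gf0 rE.
  have D2' : D ^+ 2 = D - fpsX _ ^+ 2 * fpsC (1 * fpsX rat) by rewrite mul1r.
  have := level_gf0_closed 1 1 D0 D2'.
  rewrite !mul1r rmorphB !rmorph1 mulr1 /= yE !xE.
  set G0 := level_gf _ _ _ _ 0 => E0; apply: (mulfI Dn0).
  have -> : D * (G0 * (y * (2 * (D - x)))) = 2 * y * (D * (G0 * (D - x))).
    by ring.
  by rewrite E0; ring: D2.
split.
- apply: tofrac_div; first by rewrite !nz.
  rewrite faro_gf21 word_gfE -level_gf0.
  have D2' : D ^+ 2 = D - fpsX _ ^+ 2 * fpsC (1 * fpsX rat) by rewrite mul1r.
  have := level_gf0_closed 1 (fpsX rat) D0 D2'.
  rewrite subrr mulr0 !rmorph0 !rmorph1 mulr0 addr0 mulr1 !xE.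
  set G0 := level_gf _ _ _ _ 0.
  rewrite -[RHS]mulr1 => /(mulfI Dn0) E0.
  by rewrite mulrCA E0 mulr1.
- apply: tofrac_div; first by rewrite !nz.
  have D2' : D ^+ 2 = D - fpsX _ ^+ 2 * fpsC (fpsX rat * 1) by rewrite mulr1.
  have := level_gf0_closed (fpsX rat) 1 D0 D2'.
  rewrite subrr mulr0 !rmorph0 mulr0 addr0 yE !xE.
  have := faro_gf12; rewrite word_gfE -level_gf0 rmorphB rmorph1 yE.
  set G0 := level_gf _ _ _ _ 0 => gfE.
  rewrite -[RHS]mulr1 => /(mulfI Dn0) E0.
  rewrite mulrCA mulrA gfE rE.
  have -> : (G0 + (y - 1)) * (2 * (D - x * y)) =
     2 * (G0 * (D - x * y)) + 2 * (y - 1) * (D - x * y) by ring.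
  by rewrite E0; ring.
- have den0 : y * (2 * (D - x)) != 0 by rewrite !nz.
  by rewrite (tofrac_div den0 gf132) (tofrac_div den0 gf213).
- by apply: tofrac_div => //; rewrite !nz.
apply: tofrac_div; first by rewrite !nz.
have B2' : B ^+ 2 = B - fpsX _ ^+ 2 * fpsC (1 * 1).
  by rewrite mul1r rmorph1 mulr1.
have := level_gf1_closed (fpsX rat) (fpsX rat) B0 B2'.
have := level_gf0_closed (fpsX rat) (fpsX rat) B0 B2'.
have := faro_gf123; rewrite word_gfE !mul1r !rmorphB !rmorphXn !rmorph1 !mul1r.
rewrite /= yE xE sE; set G0 := level_gf _ _ _ _ 0; set G1 := level_gf _ _ _ _ 1.
set gf := faro_gf _ => gfE E0 E1.
(* One factor B for each of G0 and G1, which are known only after multiplication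
   by B, and y^2 to reach gfE. *)
apply: (mulfI Bn0); apply: (mulfI Bn0); apply: (mulfI y0); apply: (mulfI y0).
have -> : y * (y * (B * (B * (gf * (2 * (B - x * y)))))) =
  (y ^+ 2 * gf) * B ^+ 2 * (2 * (B - x * y)) by ring.
rewrite gfE.
have -> : (1 + x * (y * G0 + y * G1) + (y ^+ 2 - 1) + x * (y ^+ 2 - y)) * B ^+ 2
    * (2 * (B - x * y)) =
  2 * (y ^+ 2 + x * (y ^+ 2 - y)) * B ^+ 2 * (B - x * y)
  + 2 * x * y * B * (B * (G0 * (B - x * y)))
  + 2 * x * y * (B * (B - x * y)) * (B * G1) by ring.
have -> : 2 * x * y * (B * (B - x * y)) * (B * G1) = 2 * x ^+ 2 * y *
   (B * (B - x * y) * (y - 1) + B * (G0 * (B - x * y))) by rewrite E1; ring.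
by rewrite E0; ring: B2.
Qed.
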